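(* Let $G$ be a 2-walk-regular graph that is not bipartite and not complete multipartite. If $G$ is uniquely vector colorable, then $G$ is a core.
   Context: Let $A$ be the adjacency matrix of $G$ and $\circ$ the entrywise (Schur) product. $G$ is 1-walk-regular if for every $\ell\in\mathbb{N}$ there are constants $a_\ell,b_\ell$ with $A^\ell\circ I=a_\ell I$ and $A^\ell\circ A=b_\ell A$. $G$ is 2-walk-regular if it is 1-walk-regular and moreover for every $\ell\in\mathbb{N}$ there is a constant $c_\ell$ with $A^\ell\circ A_2=c_\ell A_2$, where $A_2$ is the adjacency matrix of the distance-2 graph of $G$ (vertices adjacent iff at distance exactly 2 in $G$). A vector $t$-coloring assigns unit vectors $p_i$ to vertices with $\langle p_i,p_j\rangle\le-1/(t-1)$ on edges; $\chi_v(G)$ is the least $t\ge2$ admitting one; $G$ is uniquely vector colorable if any two optimal (i.e. vector $\chi_v(G)$-) colorings have equal Gram matrices. $G$ is a core if every homomorphism $G\to G$ is an automorphism. *)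

(* Defs.v *)
From HB Require Import structures.
From mathcomp Require Import all_boot all_order all_algebra.
From mathcomp Require Import reals.
Set Implicit Arguments. Unset Strict Implicit. Unset Printing Implicit Defensive.
Import Order.TTheory GRing.Theory Num.Theory.
Local Open Scope ring_scope.

Definition simple_graph (n : nat) (e : rel 'I_n) : Prop :=
  (forall i j, e i j = e j i) /\ (forall i, ~~ e i i).

Section Graphs.
Variables (R : realType) (n : nat) (e : rel 'I_n).

Definition adjmx : 'M[R]_n := \matrix_(i, j) (e i j)%:R.

Definition dist2 (i j : 'I_n) : bool :=
  [&& i != j, ~~ e i j & [exists k, e i k && e k j]].

Definition adjmx2 : 'M[R]_n := \matrix_(i, j) (dist2 i j)%:R.

Definition schur (A B : 'M[R]_n) : 'M[R]_n := \matrix_(i, j) (A i j * B i j).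

Definition one_walk_regular : Prop :=
  forall l : nat,
    (exists a : R, schur (adjmx ^+ l) 1%:M = a *: 1%:M) /\
    (exists b : R, schur (adjmx ^+ l) adjmx = b *: adjmx).

Definition two_walk_regular : Prop :=
  one_walk_regular /\
  forall l : nat, exists c : R, schur (adjmx ^+ l) adjmx2 = c *: adjmx2.

Definition dotv (d : nat) (u v : 'rV[R]_d) : R := (u *m v^T) 0 0.

Definition vector_coloring (t : R) (d : nat) (p : 'I_n -> 'rV[R]_d) : Prop :=
  (forall i, dotv (p i) (p i) = 1) /\
  (forall i j, e i j -> dotv (p i) (p j) <= - (t - 1)^-1).

Definition has_vector_coloring (t : R) : Prop :=
  exists d (p : 'I_n -> 'rV[R]_d), vector_coloring t p.

Definition is_vector_chromatic_number (t : R) : Prop :=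
  2 <= t /\ has_vector_coloring t /\
  (forall t', 2 <= t' -> has_vector_coloring t' -> t <= t').

Definition gram (d : nat) (p : 'I_n -> 'rV[R]_d) : 'M[R]_n :=
  \matrix_(i, j) dotv (p i) (p j).

Definition uniquely_vector_colorable : Prop :=
  forall t, is_vector_chromatic_number t ->
  forall d1 (p1 : 'I_n -> 'rV[R]_d1) d2 (p2 : 'I_n -> 'rV[R]_d2),
    vector_coloring t p1 -> vector_coloring t p2 -> gram p1 = gram p2.

End Graphs.

Definition bipartite (n : nat) (e : rel 'I_n) : Prop :=
  exists c : 'I_n -> bool, forall i j, e i j -> c i != c j.

Definition complete_multipartite (n : nat) (e : rel 'I_n) : Prop :=
  exists part : 'I_n -> nat, forall i j, e i j = (part i != part j).

Definition graph_hom (n : nat) (e : rel 'I_n) (f : 'I_n -> 'I_n) : Prop :=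
  forall i j, e i j -> e (f i) (f j).

Definition graph_aut (n : nat) (e : rel 'I_n) (f : 'I_n -> 'I_n) : Prop :=
  bijective f /\ forall i j, e i j = e (f i) (f j).

Definition is_core (n : nat) (e : rel 'I_n) : Prop :=
  forall f, graph_hom e f -> graph_aut e f.

(* Main.v *)
(** Let [tau] be the least eigenvalue of the adjacency matrix [A], [k] the
    degree, and [F] a nonzero symmetric polynomial in [A] with [A F = tau F].
    Walk-regularity makes [F^2] constant on the diagonal, on edges and on
    pairs at distance 2, so the normalised rows [p] of [F] form a vector
    coloring with parameter [1 - k / tau], which is optimal by the Rayleigh
    bound.  Unique colorability forces [G] to be connected and every
    endomorphism [f] to preserve the Gram matrix of [p].  If [f] identified two
    vertices at distance 2, then [p] would agree on all such pairs, making [G]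
    bipartite or complete multipartite; so [f] is injective on neighbourhoods,
    hence an automorphism. *)
Require Import Defs.
From mathcomp Require Import all_boot all_order all_algebra.
From mathcomp Require Import reals.
From mathcomp Require Import classical_sets ring lra.

Set Implicit Arguments.
Unset Strict Implicit.
Unset Printing Implicit Defensive.
Import Order.TTheory GRing.Theory Num.Theory.
Local Open Scope ring_scope.

(** * Dot products of row vectors and bounds on quadratic forms *)

Section Dotv.
Variables (R : realType) (d : nat).
Implicit Types (u v w x : 'rV[R]_d) (M : 'M[R]_d).

Lemma dotvE u v : dotv u v = \sum_k u 0 k * v 0 k.
Proof. by rewrite /dotv mxE; apply: eq_bigr => k _; rewrite mxE. Qed.

Lemma dotvC u v : dotv u v = dotv v u.
Proof. by rewrite !dotvE; apply: eq_bigr => k _; rewrite mulrC. Qed.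

Lemma dotvDl u v w : dotv (u + v) w = dotv u w + dotv v w.
Proof. by rewrite /dotv mulmxDl mxE. Qed.

Lemma dotvZl c u v : dotv (c *: u) v = c * dotv u v.
Proof. by rewrite /dotv -scalemxAl mxE. Qed.

Lemma dotvNl u v : dotv (- u) v = - dotv u v.
Proof. by rewrite -scaleN1r dotvZl mulN1r. Qed.

Lemma dotvDr u v w : dotv w (u + v) = dotv w u + dotv w v.
Proof. by rewrite !(dotvC w) dotvDl. Qed.

Lemma dotvZr c u v : dotv u (c *: v) = c * dotv u v.
Proof. by rewrite !(dotvC u) dotvZl. Qed.

Lemma dotvNr u v : dotv u (- v) = - dotv u v.
Proof. by rewrite !(dotvC u) dotvNl. Qed.

Definition dotv_lin := (dotvDl, dotvDr, dotvZl, dotvZr, dotvNl, dotvNr).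

Lemma dotv_ge0 u : 0 <= dotv u u.
Proof. by rewrite dotvE sumr_ge0 // => k _; rewrite -expr2 sqr_ge0. Qed.

Lemma dotv_eq0 u : dotv u u = 0 -> u = 0.
Proof.
rewrite dotvE => /psumr_eq0P u0; apply/rowP => k; rewrite mxE.
have /eqP := u0 (fun i _ => sqr_ge0 _) k isT.
by rewrite -expr2 sqrf_eq0 => /eqP.
Qed.

Lemma dotv_unit_eq u v :
  dotv u u = 1 -> dotv v v = 1 -> dotv u v = 1 -> u = v.
Proof.
move=> uu vv uv; apply/eqP; rewrite -subr_eq0; apply/eqP/dotv_eq0.
by rewrite !dotv_lin (dotvC v u) uu vv uv; lra.
Qed.

Lemma dotv_mulmx M u v : dotv (u *m M) v = dotv u (v *m M^T).
Proof. by rewrite /dotv trmx_mul trmxK mulmxA. Qed.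

Lemma dotv_mulmxE M u v :
  dotv (u *m M) v = \sum_i \sum_j M i j * (u 0 i * v 0 j).
Proof.
rewrite dotvE exchange_big /=; apply: eq_bigr => j _.
by rewrite mxE mulr_suml; apply: eq_bigr => i _; ring.
Qed.

Lemma dotv_delta M i j :
  dotv (delta_mx 0 i *m M) (delta_mx 0 j) = M i j.
Proof.
rewrite -rowE dotvE (bigD1 j) //= big1 ?addr0 => [|k /negPf kj].
  by rewrite !mxE !eqxx mulr1.
by rewrite !mxE kj andbF mulr0.
Qed.

Lemma dotv_delta1 i j :
  dotv (delta_mx 0 i) (delta_mx 0 j : 'rV[R]_d) = (i == j)%:R.
Proof. by have := dotv_delta 1%:M i j; rewrite mulmx1 mxE. Qed.

Lemma dotv_sqr_le u i : u 0 i ^+ 2 <= dotv u u.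
Proof.
rewrite dotvE (bigD1 i) //= -expr2 lerDl sumr_ge0 // => k _.
by rewrite -expr2 sqr_ge0.
Qed.

Lemma dotv_mulmx_bounded M :
  exists2 c, 0 < c & forall u, `|dotv (u *m M) u| <= c * dotv u u.
Proof.
(* The summand 1 keeps the constant positive. Each [|u 0 i * u 0 j|] is at most [dotv u u], because
   2|xy| <= x^2 + y^2. *)
exists (1 + \sum_i \sum_j `|M i j|).
  by rewrite ltr_pwDl // sumr_ge0 // => i _; rewrite sumr_ge0.
move=> u; rewrite dotv_mulmxE mulrDl mul1r.
apply: (@le_trans _ _ ((\sum_i \sum_j `|M i j|) * dotv u u)); last first.
  by rewrite lerDr dotv_ge0.
rewrite mulr_suml; apply: le_trans (ler_norm_sum _ _ _) _.
apply: ler_sum => i _; rewrite mulr_suml.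
apply: le_trans (ler_norm_sum _ _ _) _; apply: ler_sum => j _.
rewrite normrM ler_wpM2l // ler_norml.
have := dotv_sqr_le u i; have := dotv_sqr_le u j.
have := sqr_ge0 (u 0 i + u 0 j); have := sqr_ge0 (u 0 i - u 0 j).
by move=> *; apply/andP; split; nra.
Qed.

End Dotv.

(* The supremum [tau] of the [s] with [A - s] positive semidefinite is an
   eigenvalue: if [B = A - tau] were invertible then, for [y = x B^-1] and
   small [s > 0], expanding [0 <= (x - s y) B (x - s y)^T] would show that
   [B - s] is still positive semidefinite. *)
Lemma least_eigenvalue (R : realType) n (A : 'M[R]_n.+1) : A^T = A ->
  exists2 tau : R, (forall x, tau * dotv x x <= dotv (x *m A) x)
    & eigenvalue A tau.
Proof.
move=> symA.
pose S : set R := [set s | forall x, s * dotv x x <= dotv (x *m A) x]%classic.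
have [c c0 Ac] := dotv_mulmx_bounded A.
have S0 : (S !=set0)%classic.
  by exists (- c) => x; have := Ac x; rewrite ler_norml mulNr => /andP[].
have d1 : dotv (delta_mx 0 0 : 'rV[R]_n.+1) (delta_mx 0 0) = 1.
  by rewrite dotv_delta1.
have ubS : has_ubound S.
  exists (dotv ((delta_mx 0 0 : 'rV[R]_n.+1) *m A) (delta_mx 0 0)) => s Ss.
  by have := Ss (delta_mx 0 0); rewrite d1 mulr1.
have Stau : S (sup S).
  move=> x; have [->|x0] := eqVneq x 0.
    by rewrite mul0mx /dotv mul0mx mxE mulr0.
  have xx : 0 < dotv x x.
    rewrite lt_neqAle dotv_ge0 andbT eq_sym.
    by apply: contraNneq x0 => /dotv_eq0 ->.
  rewrite -ler_pdivlMr //; apply: ge_sup => // s Ss.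
  by rewrite ler_pdivlMr.
exists (sup S) => //; rewrite /eigenvalue /eigenspace kermx_eq0.
rewrite row_free_unit; apply/negP => unitB.
set B := A - _ in unitB.
have [C C0 BC] := dotv_mulmx_bounded (invmx B).
have symB : B^T = B by rewrite /B linearB /= symA tr_scalar_mx.
have dotB x : dotv (x *m B) x = dotv (x *m A) x - sup S * dotv x x.
  by rewrite /B mulmxBr mul_mx_scalar !dotv_lin.
suff : S (sup S + C^-1).
  by move=> /(ub_le_sup ubS); rewrite gerDl leNgt invr_gt0 C0.
(* The step size is s = 1/C: the cross terms contribute -2s|x|^2, and the bound on [invmx B] limits
   the quadratic term to s|x|^2. *)
move=> x; pose y := x *m invmx B.
have yB : y *m B = x by rewrite /y mulmxKV.
have := Stau (x - C^-1 *: y); rewrite -subr_ge0 -dotB.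
rewrite mulmxBl -scalemxAl yB !dotv_lin (dotv_mulmx B x y) symB yB dotB.
have /ler_normlP[_ yx] := BC x.
rewrite (dotvC x y) -/y in yx *.
have : C^-1 * (C^-1 * dotv y x) <= C^-1 * dotv x x.
  by rewrite ler_pM2l ?invr_gt0 // mulrC ler_pdivrMr // mulrC.
lra.
Qed.


(** * Connected graphs: colorings constant at distance 2, and locally injective endomorphisms *)

Section Graph.
Variables (n : nat) (e : rel 'I_n.+1).
Hypothesis e_simple : simple_graph e.

Let e_sym i j : e i j = e j i.
Proof. exact: e_simple.1. Qed.

Lemma path2P i k j : e i k -> e k j -> [\/ i = j, e i j | dist2 e i j].
Proof.
move=> ik kj; have [->|ij] := eqVneq i j; first by constructor 1.
have [|nij] := boolP (e i j); first by constructor 2.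
constructor 3; rewrite /dist2 ij nij; apply/existsP; exists k.
by rewrite ik.
Qed.

(** Phrased as induction along edges, which spares any reasoning about paths. *)
Definition graph_connected :=
  forall S : pred 'I_n.+1, (forall i j, e i j -> S i -> S j) ->
  forall i j, S i -> S j.

Hypothesis conn : graph_connected.

Section Coloring.
Variables (T : eqType) (p : 'I_n.+1 -> T).
Hypotheses (p_edge : forall i j, e i j -> p i != p j)
           (p_dist2 : forall i j, dist2 e i j -> p i = p j).

(** Without triangles, a walk of length 2 ends at its start or at distance 2, so [p] alternates
    between two values along every walk. *)
Lemma triangle_free_bipartite :
  (forall i j k, e i j -> e j k -> ~~ e i k) -> bipartite e.
Proof.
move=> tf; exists (fun i => p i == p ord0).
pose S i := [forall j, e i j ==> ((p i == p ord0) != (p j == p ord0))].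
suff allS i : S i by move=> i j ij; have /forallP/(_ j)/implyP := allS i; apply.
apply: (conn (S := S) _ (i := ord0)).
  move=> u v uv /forallP Su; apply/forallP => w; apply/implyP => vw.
  have -> : p w = p u.
    have [->//|uw|/p_dist2->//] := path2P uv vw.
    by have := tf _ _ _ uv vw; rewrite uw.
  by rewrite eq_sym (implyP (Su v)).
apply/forallP => j; apply/implyP => /p_edge.
by rewrite eqxx eq_sym => /negPf->.
Qed.

(* A geodesic [i, m, u, v] cannot exist: the third vertex [w] of a triangle
   on [u v] is forced to be adjacent first to [m], then to [i]. *)
Lemma triangles_complete_multipartite :
  (forall i j, e i j -> exists2 k, e i k & e k j) -> complete_multipartite e.
Proof.
move=> tri.
have ne i j : p i = p j -> e i j = false.
  by move=> ij; apply/negP => /p_edge; rewrite ij eqxx.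
have diam i j : [|| i == j, e i j | dist2 e i j].
  apply: (conn (S := fun j => [|| i == j, e i j | dist2 e i j]) _ (i := i));
    last by rewrite eqxx.
  move=> u v uv.
  have in2 m : e i m -> e m v -> [|| i == v, e i v | dist2 e i v].
    by move=> im mv; case: (path2P im mv) => ->; rewrite ?eqxx ?orbT.
  case/or3P=> [/eqP->|iu|iu]; first by rewrite uv orbT.
    exact: in2 iu uv.
  have /and3P[_ _ /existsP[m /andP[im mu]]] := iu.
  have [mv|mv|mv] := path2P mu uv; first by rewrite -mv im orbT.
    exact: in2 im mv.
  have [w uw wv] := tri _ _ uv.
  have mw : e m w.
    have [mw|//|/p_dist2 mw] := path2P mu uw.
      by move: wv; rewrite -mw (ne _ _ (p_dist2 mv)).
    by move: wv; rewrite ne // -mw (p_dist2 mv).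
  have [->|iw|/p_dist2 iw] := path2P im mw; first by rewrite wv orbT.
    exact: in2 iw wv.
  by move: uw; rewrite ne // -iw (p_dist2 iu).
(* The parts are the classes of equal [p], numbered by first occurrence in [codom p]; by [diam],
   distinct non-adjacent vertices are at distance 2 and so share a class. *)
exists (fun i => index (p i) (codom p)) => i j.
have [ij|nij] := eqVneq (index _ _) (index (p j) _).
  by apply: ne; have := congr1 (nth (p i) (codom p)) ij; rewrite !nth_index // codom_f.
have pij : p i != p j by apply: contraNneq nij => ->.
by have /or3P[/eqP ij|//|/p_dist2 ij] := diam i j; rewrite ij eqxx in pij.
Qed.

End Coloring.

(* An endomorphism that is injective on neighbourhoods of a regular graph is
   bijective on them, so its image is closed under adjacency. *)
Lemma locally_injective_aut (f : 'I_n.+1 -> 'I_n.+1) k :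
  (forall i, #|e i| = k) -> graph_hom e f ->
  (forall i j, dist2 e i j -> f i != f j) -> graph_aut e f.
Proof.
move=> reg homf injf.
have f_nbh i : {in e i &, injective f}.
  move=> a b ia ib fab.
  have ai : e a i by rewrite e_sym; exact: ia.
  have [//|/homf|/injf] := path2P ai ib; last by rewrite fab eqxx.
  by rewrite fab (negPf (e_simple.2 _)).
have nbh i : [set f x | x in e i]%SET = [set x in e (f i)]%SET.
  apply/eqP; rewrite eqEcard; apply/andP; split.
    apply/fintype.subsetP => _ /imsetP[x ix ->]; rewrite inE.
    exact: homf.
  by rewrite card_in_imset // cardsE !reg.
have surj j : j \in codom f.
  apply: (conn (S := fun j => j \in codom f) _ (i := f ord0)); last first.
    exact: codom_f.
  move=> u v uv /codomP[x ux]; rewrite ux in uv.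
  have : v \in [set y in e (f x)]%SET by rewrite inE.
  by rewrite -nbh => /imsetP[y _ ->]; apply: codom_f.
have f_inj : injective f.
  by apply/injectiveP/card_uniqP; rewrite size_codom; apply: eq_card => j; rewrite surj.
split; first exact: injF_bij.
move=> i j; apply/idP/idP => [/homf//|fij].
have : f j \in [set y in e (f i)]%SET by rewrite inE.
by rewrite -nbh => /imsetP[y iy /f_inj ->].
Qed.

End Graph.

(* On a union of components, negating the vectors shows that vectors on the
   two sides are orthogonal, and the reflection exchanging the orthogonal
   vectors [p i] and [p j] then makes two of them equal. *)
Lemma unique_coloring_connected (R : realType) n (e : rel 'I_n.+1) t d
    (p : 'I_n.+1 -> 'rV[R]_d) :
  simple_graph e -> uniquely_vector_colorable R e ->
  is_vector_chromatic_number e t -> vector_coloring e t p ->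
  graph_connected e.
Proof.
move=> e_simple uniq chi_t [p1 pe] S0 clS0 i j Si; apply/negPn/negP => Sj.
have clS a b : e a b -> S0 a = S0 b.
  by move=> ab; apply/idP/idP; apply: clS0; rewrite // e_simple.1.
have gramE (q : 'I_n.+1 -> 'rV[R]_d) : vector_coloring e t q ->
    forall a b, dotv (q a) (q b) = dotv (p a) (p b).
  move=> vq a b; have /matrixP/(_ a b) := uniq _ chi_t _ _ _ _ vq (conj p1 pe).
  by rewrite !mxE.
have orth : dotv (p i) (p j) = 0.
  pose q a := if S0 a then - p a else p a.
  have : vector_coloring e t q.
    split=> [a|a b ab]; rewrite /q -?(clS _ _ ab); case: ifP => _;
      by rewrite ?dotv_lin ?opprK // pe.
  by move=> /gramE/(_ i j); rewrite /q Si (negPf Sj) dotv_lin; lra.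
pose w := p i - p j.
have ww : dotv w w = 2.
  by rewrite /w !dotv_lin !p1 (dotvC (p j)) orth; lra.
have wi : dotv (p i) w = 1 by rewrite /w !dotv_lin p1 orth; lra.
have wj : p i - w = p j by rewrite /w subKr.
(* As [dotv w w = 2], subtracting [dotv x w *: w] from [x] is the reflection orthogonal to [w]. It
   is applied on one side only, which is harmless since no edge crosses. *)
clearbody w; pose q a := if S0 a then p a - dotv (p a) w *: w else p a.
have qq a b : S0 a = S0 b -> dotv (q a) (q b) = dotv (p a) (p b).
  rewrite /q => ->; case: ifP => // _.
  by rewrite !dotv_lin ww (dotvC w); ring.
have /gramE/(_ i j) : vector_coloring e t q.
  by split=> [a|a b ab]; rewrite qq ?(clS _ _ ab) // pe.
rewrite orth /q Si (negPf Sj).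
by rewrite wi scale1r wj p1 => /eqP; rewrite oner_eq0.
Qed.

(** * Walk-regularity and the optimal coloring from the least eigenvalue *)

Section Spectral.
Variables (R : realType) (n : nat) (e : rel 'I_n.+1).
Let A : 'M[R]_n.+1 := adjmx R e.

(** Constancy on [r] survives linear combinations of powers. It serves for the diagonal, the edges
    and the pairs at distance 2. *)
Lemma horner_mx_const (r : rel 'I_n.+1) :
  (forall l, exists b : R, forall i j, r i j -> (A ^+ l) i j = b) ->
  forall q : {poly R}, exists b : R, forall i j, r i j -> horner_mx A q i j = b.
Proof.
move=> powA q; rewrite -[q]coefK poly_def rmorph_sum /=.
elim/big_ind: _ => [|x y [a xa] [b yb]|l _].
- by exists 0 => i j _; rewrite mxE.
- by exists (a + b) => i j ij; rewrite mxE xa ?yb.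
have [b Ab] := powA l; exists (q`_l * b) => i j ij.
by rewrite horner_mxZ rmorphXn /= horner_mx_X mxE Ab.
Qed.

Lemma schur_const (B : 'M[R]_n.+1) (r : rel 'I_n.+1) :
  (exists b, schur B (\matrix_(i, j) (r i j)%:R) = b *: \matrix_(i, j) (r i j)%:R) ->
  exists b : R, forall i j, r i j -> B i j = b.
Proof.
move=> [b /matrixP Bb]; exists b => i j ij.
by have := Bb i j; rewrite !mxE ij !mulr1.
Qed.

Hypotheses (e_simple : simple_graph e) (owr : one_walk_regular R e).

Lemma trmx_adjmx : A^T = A.
Proof. by apply/matrixP => i j; rewrite !mxE e_simple.1. Qed.

Lemma horner_diag q : exists a : R, forall i, horner_mx A q i i = a.
Proof.
have [|a Aa] := @horner_mx_const [rel i j | i == j] _ q.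
  move=> l; apply: schur_const; have [a Aa] := (owr l).1; exists a.
  have -> // : \matrix_(i, j) ([rel i0 j0 | i0 == j0] i j)%:R = 1%:M :> 'M[R]_n.+1.
  by apply/matrixP => i j; rewrite !mxE.
by exists a => i; apply: Aa => /=.
Qed.

Lemma horner_edge q : exists b : R, forall i j, e i j -> horner_mx A q i j = b.
Proof. by apply: horner_mx_const => l; apply: schur_const; apply: (owr l).2. Qed.

(** The degrees are the diagonal entries of [A ^+ 2]. *)
Lemma one_walk_regular_reg : exists k, forall i, #|e i| = k.
Proof.
have [a Aa] := horner_diag ('X ^+ 2).
exists #|e ord0| => i; apply/eqP; rewrite -(eqr_nat R); apply/eqP.
suff deg j : #|e j|%:R = a by rewrite !deg.
rewrite -(Aa j) rmorphXn /= horner_mx_X expr2 mxE -sum1_card natr_sum big_mkcond /=.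
apply: eq_bigr => k _; rewrite !mxE (e_simple.1 k j).
by rewrite unfold_in; case: (e j k); rewrite ?mulr1 ?mulr0.
Qed.

(* Apply the Rayleigh bound to each coordinate of [p] and sum. *)
Lemma coloring_rayleigh tau t k d (p : 'I_n.+1 -> 'rV[R]_d) :
  (forall x, tau * dotv x x <= dotv (x *m A) x) ->
  (forall i, #|e i| = k) -> vector_coloring e t p ->
  tau <= - (k%:R / (t - 1)).
Proof.
move=> ray reg [p1 pe].
have N0 : 0 < n.+1%:R :> R by rewrite ltr0n.
rewrite -(ler_pM2r N0).
apply: (@le_trans _ _ (\sum_i \sum_j A i j * dotv (p i) (p j))).
  have -> : tau * n.+1%:R = \sum_(c < d) tau * dotv (\row_i p i 0 c) (\row_i p i 0 c).
    rewrite -mulr_sumr; congr (_ * _).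
    under eq_bigr => c _ do rewrite dotvE.
    rewrite exchange_big /= -[LHS]mulr1 -[n.+1 in LHS]card_ord -sumr_const mulr_suml.
    apply: eq_bigr => i _; rewrite mul1r -(p1 i) dotvE.
    by apply: eq_bigr => c _; rewrite !mxE.
  have -> : \sum_i \sum_j A i j * dotv (p i) (p j) =
      \sum_(c < d) dotv ((\row_i p i 0 c) *m A) (\row_i p i 0 c).
    under [RHS]eq_bigr => c _ do rewrite dotv_mulmxE.
    rewrite [RHS]exchange_big; apply: eq_bigr => i _.
    rewrite [RHS]exchange_big; apply: eq_bigr => j _ /=.
    rewrite dotvE mulr_sumr; apply: eq_bigr => c _.
    by rewrite !mxE.
  by apply: ler_sum => c _.
have -> : - (k%:R / (t - 1)) * n.+1%:R = \sum_(i < n.+1) - (k%:R / (t - 1)) :> R.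
  by rewrite sumr_const card_ord mulr_natr.
apply: ler_sum => i _; rewrite -(reg i) -sum1_card natr_sum -mulrN mulr_suml.
rewrite [leRHS]big_mkcond; apply: ler_sum => j _; rewrite mxE unfold_in.
have [ij|_] := ifPn; last by rewrite mul0r.
by rewrite !mul1r pe.
Qed.

Lemma spectral_coloring i0 j0 : e i0 j0 ->
  exists t d (p : 'I_n.+1 -> 'rV[R]_d),
    [/\ is_vector_chromatic_number e t, vector_coloring e t p
      & exists q, gram p = horner_mx A q].
Proof.
move=> e0.
have [tau ray eig] := least_eigenvalue trmx_adjmx.
have [k reg] := one_walk_regular_reg.
(* With one factor ['X - tau%:P] removed from the minimal polynomial, [g] evaluated at [A] is
   nonzero by minimality, yet annihilated by [A - tau]. *)
pose g := mxminpoly A %/ ('X - tau%:P).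
have gE : mxminpoly A = g * ('X - tau%:P).
  by rewrite divpK // dvdp_XsubCl -eigenvalue_root_min.
pose F := horner_mx A g.
have AF : F * A = tau *: F.
  have /eqP := mx_root_minpoly A; rewrite gE rmorphM /= rmorphB /=.
  rewrite horner_mx_X horner_mx_C mulrBr subr_eq0 => /eqP ->.
  by rewrite -[RHS]mul_mx_scalar.
have F0 : F != 0.
  apply/negP => /eqP/mxminpoly_min /dvdp_leq.
  have g0 : g != 0.
    by apply: contraTneq (monic_neq0 (mxminpoly_monic A)) => g0; rewrite gE g0 mul0r eqxx.
  by rewrite gE size_Mmonic ?monicXsubC // size_XsubC addn2 ltnn => /(_ g0).
have symF : F^T = F.
  rewrite /F -[g]coefK poly_def rmorph_sum linear_sum; apply: eq_bigr => l _ /=.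
  rewrite horner_mxZ rmorphXn /= horner_mx_X linearZ /=; congr (_ *: _).
  by elim: (l : nat) => [|m IH]; rewrite ?trmx1 // [in LHS]exprSr trmx_mul IH trmx_adjmx exprS.
have rowF i j : dotv (row i F) (row j F) = (F * F) i j.
  rewrite dotvE [RHS]mxE; apply: eq_bigr => l _.
  by rewrite !mxE; congr (_ * _); rewrite -[in LHS]symF mxE.
pose G := F * F.
have GE : G = horner_mx A (g * g) by rewrite rmorphM.
have [a Ga] := horner_diag (g * g); have [b Gb] := horner_edge (g * g).
rewrite -GE in Ga Gb.
have a0 : 0 < a.
  rewrite lt_neqAle -{2}(Ga ord0) -rowF dotv_ge0 andbT eq_sym.
  apply: contraNneq F0 => a0; apply/eqP/row_matrixP => i; rewrite row0.
  by apply: dotv_eq0; rewrite rowF Ga.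
(* Compare the diagonal entries at [i0] in [G * A = tau *: G]: on the left, [G] is summed over [k]
   neighbours. *)
have taua : tau * a = k%:R * b.
  have GA : G * A = tau *: G by rewrite /G -mulrA AF -scalerAr.
  have /matrixP/(_ i0 i0) := GA; rewrite [in RHS]mxE Ga => <-.
  rewrite mxE -(reg i0) -sum1_card natr_sum mulr_suml [RHS]big_mkcond /=.
  apply: eq_bigr => j _; rewrite unfold_in [A j i0]mxE (e_simple.1 j i0).
  by case: ifP => [ij|_]; rewrite ?mulr0 // mulr1 mul1r Gb.
have k0 : 0 < k%:R :> R.
  by rewrite ltr0n -(reg i0); apply/card_gt0P; exists j0.
pose p i := (Num.sqrt a)^-1 *: row i F.
have pE i j : dotv (p i) (p j) = G i j / a.
  by rewrite !dotv_lin rowF mulrA -invfM -expr2 sqr_sqrtr ?ltW // mulrC.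
clearbody p; have p1 i : dotv (p i) (p i) = 1 by rewrite pE Ga divff // gt_eqF.
have pb i j : e i j -> dotv (p i) (p j) = tau / k%:R.
  move=> ij; rewrite pE Gb //; apply/eqP.
  rewrite (eqr_div b tau (lt0r_neq0 a0) (lt0r_neq0 k0)).
  by rewrite taua mulrC.
(* This bound is what gives [2 <= t]. *)
have tauk : - k%:R <= tau.
  have := dotv_ge0 (p i0 + p j0).
  rewrite !dotv_lin !p1 (dotvC (p j0)) pb // => h.
  have : -1 <= tau / k%:R by lra.
  by rewrite ler_pdivlMr // mulN1r.
(* The test vector [x] supported on an edge has Rayleigh quotient -1. *)
have tau0 : tau < 0.
  pose x : 'rV[R]_n.+1 := delta_mx 0 i0 - delta_mx 0 j0.
  have ij : (i0 == j0) = false.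
    by apply/eqP => ij; have := e_simple.2 i0; rewrite [in X in e _ X]ij e0.
  have := ray x.
  rewrite /x !mulmxBl !dotv_lin !dotv_delta !dotv_delta1 !mxE !eqxx (eq_sym j0) ij.
  rewrite (e_simple.1 j0) e0 !(negPf (e_simple.2 _)) /=.
  lra.
(* The parameter solves -1/(t - 1) = tau/k, the inner product on edges. *)
exists (1 - k%:R / tau), n.+1, p.
have colp : vector_coloring e (1 - k%:R / tau) p.
  split=> // i j ij; rewrite pb //.
  by rewrite addrAC subrr add0r invrN opprK invf_div.
split=> //; last first.
  exists (a^-1 *: (g * g)); apply/matrixP => i j.
  by rewrite [LHS]mxE pE horner_mxZ -GE [RHS]mxE mulrC.
split; last split.
- suff: 1 <= - (k%:R / tau) by lra.
  by rewrite -mulrN -invrN ler_pdivlMr ?oppr_gt0 // mul1r; lra.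
- by exists n.+1, p.
move=> t' t2 [d [p' /(coloring_rayleigh ray reg)]] h.
have t0 : 0 < t' - 1 by lra.
suff : k%:R / - tau <= t' - 1 by rewrite invrN mulrN; lra.
rewrite ler_pdivrMr ?oppr_gt0 // mulrC -ler_pdivrMr //.
by rewrite lerNr in h.
Qed.

End Spectral.

Theorem theorem4p11 (R : realType) (n : nat) (e : rel 'I_n) :
  simple_graph e ->
  two_walk_regular R e ->
  ~ bipartite e ->
  ~ complete_multipartite e ->
  uniquely_vector_colorable R e ->
  is_core e.
Proof.
case: n e => [|n] e e_simple [owr twr] nbip ncm uniq f homf.
  by case: nbip; exists xpredT => -[].
have [i0 [j0 e0]] : exists i j, e i j.
  have [/existsP[i /existsP[j ij]]|] := boolP [exists i, exists j, e i j].
    by exists i, j.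
  move=> /existsPn noe; case: nbip; exists xpredT => i j ij.
  by have /existsPn/(_ j) := noe i; rewrite ij.
have [t [d [p [chi_t colp [q gramq]]]]] := spectral_coloring e_simple owr e0.
have conn := unique_coloring_connected e_simple uniq chi_t colp.
have [k reg] := one_walk_regular_reg e_simple owr.
have [p1 pe] := colp.
have gramE i j : dotv (p i) (p j) = gram p i j by rewrite mxE.
have pf i j : dotv (p (f i)) (p (f j)) = dotv (p i) (p j).
  have colf : vector_coloring e t (p \o f).
    by split=> [a|a b ab] /=; [exact: p1|apply/pe/homf].
  by have /matrixP/(_ i j) := uniq _ chi_t _ _ _ _ colf colp; rewrite !mxE.
apply: (locally_injective_aut e_simple conn reg homf) => i j ij.
apply/negP => /eqP fij.
(* The Gram entry is constant at distance 2, and the pair identified by [f] shows that this constant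
   is 1. *)
have [c qc] : exists c, forall a b, dist2 e a b -> horner_mx (adjmx R e) q a b = c.
  by apply: horner_mx_const => l; apply: schur_const; apply: twr.
have p_dist2 a b : dist2 e a b -> p a = p b.
  move=> ab; apply: dotv_unit_eq => //.
  by rewrite gramE gramq (qc _ _ ab) -(qc _ _ ij) -gramq -gramE -pf fij p1.
have p_edge a b : e a b -> p a != p b.
  move=> ab; apply/negP => /eqP pab; have := pe _ _ ab; rewrite pab p1.
  have : 0 < (t - 1)^-1 by rewrite invr_gt0; have [] := chi_t; lra.
  lra.
(* Here [b] counts the triangles on an edge, so one triangle in the graph puts every edge in a
   triangle. *)
have [b Ab] := horner_edge owr ('X ^+ 2).
have A2 u v : horner_mx (adjmx R e) ('X ^+ 2) u v = \sum_w (e u w && e w v)%:R.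
  rewrite rmorphXn /= horner_mx_X expr2 mxE; apply: eq_bigr => w _.
  by rewrite !mxE mulrb; case: (e u w); rewrite ?mul0r ?mul1r.
have [/existsP[u /existsP[v /existsP[w /and3P[uv vw uw]]]]|/existsPn notri] :=
    boolP [exists u, exists v, exists w, [&& e u v, e v w & e u w]].
  apply: ncm; apply: (triangles_complete_multipartite conn p_edge p_dist2).
  move=> x y xy; have [/existsP[z /andP[xz zy]]|/existsPn noz] :=
    boolP [exists z, e x z && e z y]; first by exists z.
  have := Ab _ _ uw; rewrite -(Ab _ _ xy) !A2 [RHS]big1; last first.
    by move=> z _; rewrite (negPf (noz z)).
  move=> /eqP; rewrite psumr_eq0 => [/allP/(_ v (mem_index_enum _))|z _].
    by rewrite uv vw oner_eq0.
  exact: ler0n.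
apply: nbip; apply: (triangle_free_bipartite conn p_edge p_dist2).
move=> u v w uv vw; apply/negP => uw.
have /existsPn/(_ v)/existsPn/(_ w) := notri u.
by rewrite uv vw uw.
Qed.
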